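(* Let $G$ be a graph with an almost universal node $u$ (a node adjacent to all nodes of $G$ other than itself except exactly one). If the graph $G'$ obtained from $G$ by removing $u$ is a PCG, then $G$ is a 2-interval PCG.
   Context: Graphs are finite and simple. For a tree $T$ with non-negative real edge weights whose leaves are identified with the nodes of a graph, $d_T(u,v)$ denotes the weighted distance in $T$ between the leaves associated to $u$ and $v$. A graph $G=(V,E)$ is a PCG (pairwise compatibility graph) if there exist a tree $T$ with non-negative real edge weights, a bijection between $V$ and the leaves of $T$, and an interval $I$ of the non-negative real half-line such that for distinct $u,v\in V$, $(u,v)\in E$ if and only if $d_T(u,v)\in I$. A graph is a 2-interval PCG if the same holds with two disjoint intervals $I_1,I_2$ of the non-negative real half-line in place of $I$, with the condition $d_T(u,v)\in I_1\cup I_2$. *)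

(* Defs.v *)
From mathcomp Require Import all_boot all_order all_algebra.
From mathcomp Require Import boolp classical_sets functions set_interval reals.

Set Implicit Arguments.
Unset Strict Implicit.
Unset Printing Implicit Defensive.

Import Order.TTheory GRing.Theory Num.Theory.

Local Open Scope classical_set_scope.
Local Open Scope ring_scope.

Definition simple_graph (V : finType) (E : rel V) : Prop :=
  symmetric E /\ irreflexive E.

Definition remove_node (V : finType) (E : rel V) (u : V) :
    rel {x : V | x != u} :=
  relpre val E.
Arguments remove_node {V} E u.

Definition almost_universal (V : finType) (E : rel V) (u : V) : Prop :=
  #|[set v : V | (v != u) && ~~ E u v]%SET| = 1%N.

(* [ucycle] bounds no length: in a simple graph the empty sequence and every
   pair of adjacent vertices satisfy it, hence the condition [2 < size c]. *)
Definition acyclic (T : finType) (F : rel T) : Prop :=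
  forall c : seq T, (2 < size c)%N -> ~ ucycle F c.

Definition tree (T : finType) (F : rel T) : Prop :=
  [/\ (0 < #|T|)%N, simple_graph F, forall x y, connect F x y & acyclic F].

(* In a tree with at least two vertices every degree is positive, so this is
   "degree exactly 1"; the vertex of the one-vertex tree also counts as a
   leaf. *)
Definition leaf (T : finType) (F : rel T) (x : T) : Prop :=
  (#|[set y | F x y]%SET| <= 1)%N.

(* As in [path], the vertices of the walk are [x :: p]; the weight of the edge
   between y and z is [w [set y; z]], which makes weights symmetric. *)
Fixpoint walk_weight (R : realType) (T : finType) (w : {set T} -> R)
    (x : T) (p : seq T) : R :=
  if p is y :: p' then w [set x; y]%SET + walk_weight w y p' else 0.

Definition simple_path (T : finType) (F : rel T) (x y : T) (p : seq T) : Prop :=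
  [/\ path F x p, last x p = y & uniq (x :: p)].

(* If F is a tree there is exactly one simple path from x to y, and [xget]
   returns it; the default [[::]] is never used. *)
Definition tree_dist (R : realType) (T : finType) (F : rel T)
    (w : {set T} -> R) (x y : T) : R :=
  walk_weight w x (xget [::] [set p | simple_path F x y p]).

Definition nonneg_weights (R : realType) (T : finType) (F : rel T)
    (w : {set T} -> R) : Prop :=
  forall x y, F x y -> 0 <= w [set x; y]%SET.

Definition compatible_with (R : realType) (V : finType) (E : rel V)
    (D : set R) : Prop :=
  exists (T : finType) (F : rel T) (w : {set T} -> R) (f : V -> T),
    [/\ tree F, nonneg_weights F w, set_bij [set: V] [set x | leaf F x] f &
        forall u v : V, u != v -> (E u v <-> D (tree_dist F w (f u) (f v)))].

(* [interval R] has intervals of every kind: open, closed or half-open at each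
   end, bounded or not, possibly empty. *)
Definition nonneg_interval (R : realType) (I : interval R) : Prop :=
  [set` I] `<=` [set x | 0 <= x].

Definition is_PCG (R : realType) (V : finType) (E : rel V) : Prop :=
  exists I : interval R, nonneg_interval I /\ compatible_with E [set` I].

Definition is_2interval_PCG (R : realType) (V : finType) (E : rel V) : Prop :=
  exists I1 I2 : interval R,
    [/\ nonneg_interval I1, nonneg_interval I2,
        [set` I1] `&` [set` I2] = set0 &
        compatible_with E ([set` I1] `|` [set` I2])].

(* Main.v *)
(** Let [v0] be the non-neighbour of [u].  In a tree witnessing that [G - u] is
    a PCG, lengthening every pendant edge by 1 shifts all distances between
    distinct leaves by 2, hence makes them positive.  Hang two new leaves from
    the old leaf of [v0]: one by an edge of weight 0, which becomes the leaf of
    [v0], and one by an edge of weight [M], larger than all distances so far,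
    which becomes the leaf of [u].  Then [u] is at distance exactly [M] from
    [v0] and at distance more than [M] from every other node, so the shifted
    interval cut below [M] and the interval ]M, +oo[ witness the claim. *)
Require Import Defs.
From mathcomp Require Import all_boot all_order all_algebra.
From mathcomp Require Import boolp classical_sets functions set_interval reals.
From mathcomp Require Import lra.

Set Implicit Arguments.
Unset Strict Implicit.
Unset Printing Implicit Defensive.

Import Order.TTheory GRing.Theory Num.Theory.

Local Open Scope ring_scope.

(** * Distances in a weighted tree, read off from simple paths *)

Section TreeDistance.
Variables (R : realType) (T : finType) (F : rel T).
Implicit Types (w : {set T} -> R) (x y z : T) (p q : seq T).

Lemma simple_path_exists x y : connect F x y -> exists p, simple_path F x y p.
Proof.
case/connectP=> p Fp ->; case/shortenP: Fp => q Fq Uq _.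
by exists q.
Qed.

Lemma simple_path_unique x y p q :
  symmetric F -> acyclic F ->
  simple_path F x y p -> simple_path F x y q -> p = q.
Proof.
move=> symF acF; elim: p x q => [|a p IHp] x [|b q] //.
- by case=> _ /= <- _ [_ /= Lq] /andP[]; rewrite -{1}Lq mem_last.
- by case=> _ /= Lp /andP[+ _] [_ /= Lq _]; rewrite Lq -{1}Lp mem_last.
case=> /= /andP[Fxa Fp] Lp /andP[xNp Up] [/= /andP[Fxb Fq] Lq /andP[xNq Uq]].
have [eq_ab|neq_ab] := eqVneq a b.
  by rewrite -eq_ab in Fq Lq Uq *; congr (_ :: _); apply: (IHp a).
(* [p] followed by the reverse of [q] joins [a] to [b] without meeting [x],
   which closes a cycle through [x]. *)
have Frev : path F y (rev (belast b q)).
  by rewrite -Lq rev_path (eq_path (e' := F)) // => s t; rewrite symF.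
have Lrev : last y (rev (belast b q)) = b.
  by rewrite -Lq; case: (q) => //= c r; rewrite rev_cons last_rcons.
have Fcat : path F a (p ++ rev (belast b q)) by rewrite cat_path Fp Lp.
have Lcat : last a (p ++ rev (belast b q)) = b by rewrite last_cat Lp.
(* The two halves may meet, so the walk is shortened; [sub_r] keeps [x] off [r], and [a != b] makes
   [r] nonempty, so the cycle has at least three vertices. *)
case/shortenP: Fcat Lcat => r Fr Ur sub_r Lr.
case: (acF (x :: a :: r)).
  by case: (r) Lr => //= eq_ab; rewrite eq_ab eqxx in neq_ab.
rewrite /ucycle /= Fxa rcons_path Fr Lr symF Fxb /=.
have xNr : x \notin r.
  apply/negP => /sub_r; rewrite mem_cat mem_rev => /orP[xp|/mem_belast xq].
    by rewrite inE xp orbT in xNp.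
  by rewrite xq in xNq.
move: Ur => /= ->; rewrite inE negb_or xNr !andbT.
by move: xNp; rewrite inE negb_or => /andP[].
Qed.

(** Uniqueness removes the choice made by [xget]: any exhibited simple path computes the
    distance. *)
Lemma tree_dist_simple_path w x y p :
  tree F -> simple_path F x y p -> tree_dist F w x y = walk_weight w x p.
Proof.
case=> _ [symF _] _ acF Pp; congr walk_weight.
by apply: (simple_path_unique symF acF _ Pp); apply: (xgetI _ Pp).
Qed.

Lemma tree_dist_refl w x : tree F -> tree_dist F w x x = 0.
Proof. by move=> tF; rewrite (@tree_dist_simple_path _ _ _ [::]). Qed.

Lemma walk_weight_rcons w x p y :
  walk_weight w x (rcons p y) = walk_weight w x p + w [set last x p; y]%SET.
Proof. by elim: p x => [|z p IHp] x /=; rewrite ?addr0 ?add0r // IHp addrA. Qed.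

Lemma last_rev_belast x p : last (last x p) (rev (belast x p)) = x.
Proof. by case: p => //= y p; rewrite rev_cons last_rcons. Qed.

(** Weights sit on unordered pairs, and [rev (belast x p)] is the walk [x :: p] read backwards,
    without its first vertex. *)
Lemma walk_weight_rev w x p :
  walk_weight w (last x p) (rev (belast x p)) = walk_weight w x p.
Proof.
elim: p x => [|y p IHp] x //=.
by rewrite rev_cons walk_weight_rcons IHp last_rev_belast addrC finset.setUC.
Qed.

Lemma tree_dist_sym w x y : tree F -> tree_dist F w x y = tree_dist F w y x.
Proof.
move=> tF; have [_ [symF _] conF _] := tF.
have [p Pp] := simple_path_exists (conF x y); have [Fp Lp Up] := Pp.
rewrite (tree_dist_simple_path w tF Pp) -walk_weight_rev Lp.
symmetry; apply: tree_dist_simple_path => //; split.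
- by rewrite -Lp rev_path (eq_path (e' := F)) // => s t; rewrite symF.
- by rewrite -Lp last_rev_belast.
- by rewrite -Lp -rev_rcons -lastI rev_uniq.
Qed.

Lemma walk_weight_ge0 w x p :
  nonneg_weights F w -> path F x p -> 0 <= walk_weight w x p.
Proof.
move=> w0; elim: p x => [|y p IHp] x //= /andP[Fxy Fp].
by rewrite addr_ge0 ?w0 ?IHp.
Qed.

Lemma tree_dist_ge0 w x y :
  tree F -> nonneg_weights F w -> 0 <= tree_dist F w x y.
Proof.
move=> tF w0; have [_ _ conF _] := tF.
have [p Pp] := simple_path_exists (conF x y).
by rewrite (tree_dist_simple_path w tF Pp) walk_weight_ge0 //; case: Pp.
Qed.

(** * Shifting leaf distances by lengthening pendant edges *)

Definition leafb x : bool := (#|[set y | F x y]%SET| <= 1)%N.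

(** Leaf ends are counted, so the single edge of a two-vertex tree gains 2 and the shift is the same
    for all pairs of distinct leaves. *)
Definition lengthen_pendant w (A : {set T}) : R :=
  w A + #|[set x in A | leafb x]%SET|%:R.

Lemma lengthen_pendant_edge w x y :
  x != y ->
  lengthen_pendant w [set x; y]%SET
    = w [set x; y]%SET + (leafb x)%:R + (leafb y)%:R.
Proof.
move=> xNy; rewrite /lengthen_pendant -addrA -natrD; congr (_ + _%:R).
rewrite -sum1_card (eq_bigl (fun z => (z \in [set x; y]%SET) && leafb z)).
  by rewrite big_mkcondr big_setU1 ?inE //= big_set1; do 2!case: leafb.
by move=> z; rewrite !inE.
Qed.

Lemma nonneg_lengthen_pendant w :
  nonneg_weights F w -> nonneg_weights F (lengthen_pendant w).
Proof. by move=> w0 x y Fxy; rewrite addr_ge0 ?w0 ?ler0n. Qed.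

(** An inner vertex of a simple path has two distinct neighbours on it, so only the endpoints can be
    leaves. The start is arbitrary because the induction restarts at inner vertices. *)
Lemma walk_weight_lengthen_pendant w x y p :
  symmetric F -> path F x (y :: p) -> uniq (x :: y :: p) ->
  leaf F (last y p) ->
  walk_weight (lengthen_pendant w) x (y :: p)
    = walk_weight w x (y :: p) + (leafb x)%:R + 1.
Proof.
move=> symF; elim: p x y => [|z p IHp] x y.
  rewrite /= inE => _ /andP[xNy _] Ly; rewrite lengthen_pendant_edge //.
  by rewrite /leafb Ly !addr0.
move=> Fp Up Lp; move: Fp Up => /= /andP[Fxy Fp] /andP[xNp Up].
have xNy : x != y by move: xNp; rewrite inE negb_or => /andP[].
have xNz : x != z by move: xNp; rewrite !inE !negb_or => /and3P[].
have yNleaf : leafb y = false.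
  apply/negbTE; rewrite -ltnNge; apply/card_gt1P; exists x, z.
  by rewrite !inE symF Fxy xNz; case/andP: Fp.
rewrite -[LHS]/(_ + walk_weight _ y (z :: p)) IHp // lengthen_pendant_edge //.
by rewrite yNleaf /=; lra.
Qed.

Lemma tree_dist_lengthen_pendant w x y :
  tree F -> leaf F x -> leaf F y -> x != y ->
  tree_dist F (lengthen_pendant w) x y = tree_dist F w x y + 2.
Proof.
move=> tF Lx Ly xNy; have [_ [symF _] conF _] := tF.
have [p Pp] := simple_path_exists (conF x y).
rewrite !(tree_dist_simple_path _ tF Pp).
case: p Pp => [|z p] [Fp Lp Up]; first by rewrite -Lp eqxx in xNy.
rewrite walk_weight_lengthen_pendant //; last by move: Lp => /= ->.
by rewrite /leafb Lx -addrA.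
Qed.

End TreeDistance.

(** * Attaching a pendant vertex to a tree *)

Section AddLeaf.
Variables (R : realType) (T : finType) (F : rel T) (a : T).
Implicit Types (w : {set T} -> R) (x y : T).

Definition add_leaf : rel (option T) := fun s t =>
  match s, t with
  | Some x, Some y => F x y
  | Some x, None | None, Some x => x == a
  | None, None => false
  end.

(** The only edge through the new vertex [None] leads to [a], so membership of [None] identifies
    it. *)
Definition add_leaf_weight w (m : R) (A : {set option T}) : R :=
  if None \in A then m else w (Some @^-1: A)%SET.

Lemma add_leaf_Some_path x p :
  path add_leaf (Some x) (map Some p) = path F x p.
Proof. by elim: p x => [|y p IHp] x //=; rewrite IHp. Qed.

Lemma notin_None_map (s : seq (option T)) :
  None \notin s -> exists s', s = map Some s'.
Proof.
elim: s => [|[x|] s IHs] //; first by exists [::].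
by rewrite inE /= => /IHs[s' ->]; exists (x :: s').
Qed.

Lemma simple_add_leaf : simple_graph F -> simple_graph add_leaf.
Proof.
case=> symF irrF; split; first by move=> [x|] [y|] //=; exact: symF.
by move=> [x|] //=; exact: irrF.
Qed.

(** A cycle avoiding [None] is a cycle of [F]. One through [None], rotated to start there, has
    [Some a] both second and last, two distinct positions as the length exceeds 2. *)
Lemma acyclic_add_leaf : acyclic F -> acyclic add_leaf.
Proof.
move=> acF c c_gt2 /andP[Fc Uc].
have [cN|/notin_None_map[c' Ec]] := boolP (None \in c); last first.
  apply: (acF c'); first by rewrite -(size_map Some) -Ec.
  rewrite /ucycle -(map_inj_uniq Some_inj) -Ec Uc andbT.
  move: Fc; rewrite Ec; case: (c') => //= x s.
  by rewrite -map_rcons add_leaf_Some_path.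
have [i s Es] := rot_to cN.
move: Fc Uc c_gt2; rewrite -(rot_cycle i) -(rot_uniq i) -(size_rot i) Es.
case: s {Es} => // s0 s /=; rewrite rcons_path.
case/lastP: s => // s s1; rewrite last_rcons.
case: s0 => [x|]; last by [].
case: s1 => [y|]; last by rewrite andbF andbF.
move=> /and3P[/eqP-> _ /eqP->].
by case/and3P=> _; rewrite mem_rcons mem_head.
Qed.

Lemma tree_add_leaf : tree F -> tree add_leaf.
Proof.
case=> T0 sF conF acF; have sF' := simple_add_leaf sF.
split=> //; last exact: acyclic_add_leaf.
  by apply/card_gt0P; exists None.
have csym := sym_connect_sym (proj1 sF').
have conS x y : connect add_leaf (Some x) (Some y).
  have /connectP[p Fp ->] := conF x y.
  by apply/connectP; exists (map Some p); rewrite ?add_leaf_Some_path ?last_map.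
have conN y : connect add_leaf None (Some y).
  by apply: connect_trans (conS a y); apply: connect1 => /=.
by move=> [x|] [y|] //; rewrite csym.
Qed.

Lemma degree_add_leaf_Some x :
  #|[set t | add_leaf (Some x) t]%SET| = ((x == a) + #|[set y | F x y]%SET|)%N.
Proof.
rewrite (cardsD1 None) inE /=; congr (_ + _)%N.
rewrite -(card_imset _ Some_inj); apply: eq_card => -[y|].
  by rewrite !inE /= mem_imset ?inE //; exact: Some_inj.
by rewrite !inE /=; apply/esym/imsetP => -[].
Qed.

Lemma leaf_add_leaf_None : leaf add_leaf None.
Proof.
rewrite /leaf (_ : finset _ = [set Some a]%SET) ?cards1 //.
by apply/setP => -[x|]; rewrite !inE.
Qed.

Lemma add_leaf_weight_edge w m x y :
  add_leaf_weight w m [set Some x; Some y]%SET = w [set x; y]%SET.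
Proof.
rewrite /add_leaf_weight !inE /=; congr w.
by apply/setP => z; rewrite !inE.
Qed.

Lemma nonneg_add_leaf_weight w m :
  0 <= m -> nonneg_weights F w -> nonneg_weights add_leaf (add_leaf_weight w m).
Proof.
move=> m0 w0 [x|] [y|] // Fxy.
- by rewrite add_leaf_weight_edge w0.
- by rewrite /add_leaf_weight !inE eqxx orbT.
- by rewrite /add_leaf_weight !inE.
Qed.

Lemma walk_weight_add_leaf w m x p :
  walk_weight (add_leaf_weight w m) (Some x) (map Some p) = walk_weight w x p.
Proof. by elim: p x => [|y p IHp] x //=; rewrite IHp add_leaf_weight_edge. Qed.

Lemma simple_path_add_leaf x y p :
  simple_path F x y p -> simple_path add_leaf (Some x) (Some y) (map Some p).
Proof.
case=> Fp Lp Up; split; first by rewrite add_leaf_Some_path.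
  by rewrite last_map Lp.
by rewrite -(map_inj_uniq Some_inj) in Up.
Qed.

Lemma tree_dist_add_leaf w m x y :
  tree F ->
  tree_dist add_leaf (add_leaf_weight w m) (Some x) (Some y)
    = tree_dist F w x y.
Proof.
move=> tF; have [_ _ conF _] := tF.
have [p Pp] := simple_path_exists (conF x y).
rewrite (tree_dist_simple_path _ (tree_add_leaf tF) (simple_path_add_leaf Pp)).
by rewrite walk_weight_add_leaf (tree_dist_simple_path _ tF Pp).
Qed.

Lemma tree_dist_add_leaf_None w m y :
  tree F ->
  tree_dist add_leaf (add_leaf_weight w m) None (Some y)
    = m + tree_dist F w a y.
Proof.
move=> tF; have [_ _ conF _] := tF.
have [p Pp] := simple_path_exists (conF a y).
have [Fp Lp Up] := simple_path_add_leaf Pp.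
rewrite (@tree_dist_simple_path _ _ _ _ _ _ (Some a :: map Some p)).
- rewrite /= walk_weight_add_leaf (tree_dist_simple_path _ tF Pp).
  by rewrite /add_leaf_weight !inE.
- exact: tree_add_leaf.
- split=> //; first by rewrite /= eqxx.
  by rewrite cons_uniq Up inE /= andbT; apply/negP => /mapP[].
Qed.

End AddLeaf.

(** * Translated intervals and a bound on finitely many reals *)

Lemma itv_shift (R : realType) (I : interval R) (c : R) :
  exists J : interval R, forall x, (x \in J) = (x - c \in I).
Proof.
pose s (b : itv_bound R) := if b is BSide k t then BSide k (t + c) else b.
case: I => l r; exists (Interval (s l) (s r)) => x.
rewrite !itv_boundlr; congr (_ && _).
  by case: l => [[] t|[]] //=; rewrite !bnd_simp ?lerBrDr ?ltrBrDr.
by case: r => [[] t|[]] //=; rewrite !bnd_simp ?lerBlDr ?ltrBlDr.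
Qed.

Lemma finite_strict_bound (R : realType) (I : finType) (g : I -> R) :
  exists2 M : R, 0 < M & forall i, g i < M.
Proof.
(* The summand 1 makes the bound strict, and positive even if [I] is empty. *)
exists (1 + \sum_i `|g i|) => [|i]; first by rewrite ltr_pwDl ?sumr_ge0.
rewrite (bigD1 i) //= addrCA (le_lt_trans (ler_norm _)) // ltrDl.
by rewrite ltr_pwDl ?sumr_ge0.
Qed.

Local Open Scope classical_set_scope.

(** * The witness tree, its leaf map and the two intervals *)

Theorem theorem2 (R : realType) (V : finType) (E : rel V) (u : V) :
  simple_graph E ->
  almost_universal E u ->
  is_PCG R (remove_node E u) ->
  is_2interval_PCG R E.
Proof.
move=> [symE _] /eqP/cards1P[v Nu] [I [I0 [T [F [w [f [tF w0 fbij fE]]]]]]].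
have vu : v != u.
  by have := set11 v; rewrite -Nu inE => /andP[].
have {}Nu x : x != u -> E u x = (x != v).
  by move=> xu; move/setP/(_ x): Nu; rewrite !inE xu /= => <-; rewrite negbK.
have [flf finj fsurj] := fbij.
have {}flf z : leaf F (f z) by apply: flf.
have {}finj : injective f by move=> x y; apply: finj; rewrite inE.
pose v0 : {x : V | x != u} := Sub v vu.
pose w1 := lengthen_pendant F w.
have w10 : nonneg_weights F w1 by apply: nonneg_lengthen_pendant.
have w1E y z : y != z ->
    tree_dist F w1 (f y) (f z) = tree_dist F w (f y) (f z) + 2.
  by move=> yz; rewrite tree_dist_lengthen_pendant // (inj_eq finj).
have [M M0 Mgt] := finite_strict_bound
  (fun yz : {x : V | x != u} * {x : V | x != u} =>
     tree_dist F w1 (f yz.1) (f yz.2)).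
have {}Mgt y z : tree_dist F w1 (f y) (f z) < M by apply: (Mgt (y, z)).
pose a := f v0.
(* In the final tree [None] is the leaf of [u], [Some None] that of [v], and [Some (Some t)] the old
   vertex [t]. *)
pose F1 := add_leaf F a; pose w2 := add_leaf_weight w1 0.
have tF1 : tree F1 by apply: tree_add_leaf.
have w20 : nonneg_weights F1 w2 by apply: nonneg_add_leaf_weight.
pose F2 := add_leaf F1 (Some a); pose w3 := add_leaf_weight w2 M.
have tF2 : tree F2 by apply: tree_add_leaf.
have w30 : nonneg_weights F2 w3 by apply: nonneg_add_leaf_weight; rewrite ?ltW.
pose g z := if z == v0 then None else Some (f z).
have ginj : injective g.
  move=> y z; rewrite /g; case: eqP => [->|_]; case: eqP => [->|_] //.
  by case=> /finj.
(* The edge of weight 0 lets the new leaf stand in for [a] without changing distances. *)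
have gE y z : y != z ->
    tree_dist F2 w3 (Some (g y)) (Some (g z)) = tree_dist F w (f y) (f z) + 2.
  move=> yz; rewrite -w1E // tree_dist_add_leaf // /g.
  case: eqP => [yv|_]; case: eqP => [zv|_].
  - by rewrite yv zv eqxx in yz.
  - by rewrite tree_dist_add_leaf_None // add0r yv.
  - by rewrite tree_dist_sym // tree_dist_add_leaf_None // add0r zv tree_dist_sym.
  - by rewrite tree_dist_add_leaf.
have gNv0 : tree_dist F2 w3 None (Some (g v0)) = M.
  rewrite tree_dist_add_leaf_None // /g eqxx tree_dist_sym //.
  by rewrite tree_dist_add_leaf_None // tree_dist_refl // !addr0.
(* Distinct leaves may be at distance 0 under [w]; the shift by 2 makes the inequality strict. *)
have gN z : z != v0 -> M < tree_dist F2 w3 None (Some (g z)).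
  move=> zv; rewrite tree_dist_add_leaf_None // /g (negbTE zv) ltrDl.
  rewrite tree_dist_add_leaf // w1E 1?eq_sym //.
  by rewrite ltr_wpDl ?tree_dist_ge0 ?ltr0n.
have [J JE] := itv_shift I 2.
(* [insub] fails exactly at [u], which thus goes to the outer [None]. *)
pose h (x : V) : option (option T) := omap g (insub x).
have hu : h u = None by rewrite /h insubF ?eqxx.
have hval z : h (val z) = Some (g z) by rewrite /h valK.
have cases x : x = u \/ exists z : {x : V | x != u}, x = val z.
  by have [->|xu] := eqVneq x u; [left|right; exists (Sub x xu)].
(* Both intervals omit [M], the distance realised by the non-adjacent pair [u], [v]. *)
exists (J `&` `]-oo, M[)%O, (`]M, +oo[)%O; split.
- move=> x /=; rewrite in_itvI JE => /andP[/I0 /= x2 _].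
  by rewrite (le_trans x2) // gerBl ler0n.
- by move=> x /=; rewrite in_itv /= andbT => /ltW; apply: le_trans; apply: ltW.
- apply/seteqP; split=> x //=; rewrite in_itvI !in_itv /= andbT.
  by case=> /andP[_ xM] /(lt_trans xM); rewrite ltxx.
exists (option (option T)), F2, w3, h; split=> //.
- split.
  + move=> x _; have [->|[z ->]] := cases x.
      by rewrite hu; apply: leaf_add_leaf_None.
    rewrite hval /g /= /leaf degree_add_leaf_Some.
    have [_|zv] := eqVneq z v0; first exact: leaf_add_leaf_None.
    rewrite (inj_eq Some_inj) degree_add_leaf_Some (inj_eq finj) (negbTE zv).
    exact: flf.
  + move=> x y _ _; have [->|[z ->]] := cases x; have [->|[t ->]] := cases y;
      by rewrite ?hu ?hval // => -[/ginj->].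
  + move=> [[t|]|] /= lt; last by exists u.
      move: lt; rewrite /leaf /F2 degree_add_leaf_Some (inj_eq Some_inj).
      rewrite degree_add_leaf_Some.
      (* Both new leaves hang from [a], so its degree is at least 2 even if the old tree is a single
         vertex: it is no leaf and needs no preimage. *)
      have [->|ta] := eqVneq t a; first by [].
      rewrite !add0n => /(fsurj t)[z _ ft]; exists (val z) => //.
      rewrite hval /g; case: eqP => [zv|_]; last by rewrite ft.
      by rewrite -ft zv eqxx in ta.
    by exists v => //; rewrite -[v]/(val v0) hval /g eqxx.
have DE d : ([set` (J `&` `]-oo, M[)%O] `|` `]M, +oo[) d
    <-> (d - 2 \in I) && (d < M) || (M < d).
  rewrite /= in_itvI JE [d \in `]-oo, M[%O]in_itv [d \in `]M, +oo[%O]in_itv /=.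
  by rewrite andbT; split=> /orP.
have uE (z : {x : V | x != u}) : E u (val z) <->
    ([set` (J `&` `]-oo, M[)%O] `|` `]M, +oo[)
      (tree_dist F2 w3 None (Some (g z))).
  rewrite DE Nu ?(valP z) // -[v]/(val v0) (inj_eq val_inj).
  have [->|zv] := eqVneq z v0; first by rewrite gNv0 ltxx andbF.
  by rewrite gN // orbT.
move=> x y; have [->|[z ->]] := cases x; have [->|[t ->]] := cases y.
- by rewrite eqxx.
- by move=> _; rewrite hu hval.
- by move=> _; rewrite hu hval symE tree_dist_sym.
rewrite (inj_eq val_inj) !hval => zt.
rewrite (_ : E (val z) (val t) = remove_node E u z t) // fE // gE //.
(* Pairs avoiding [u] stay below [M], so [J] alone decides their adjacency. *)
have ltM : tree_dist F w (f z) (f t) + 2 < M by rewrite -w1E.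
by rewrite DE addrK ltM andbT ltNge (ltW ltM) orbF.
Qed.
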